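(* Let $d\ge2$ and suppose that $t\in\left(\frac1{e\,\mu_{d-1}},\frac1{\mu_d}\right)$. Define $\xi_t=|\log(\mu_{d-1}t)|$ (with $\mu_1=1$). For $N\ge1$ let $G_N(a,t)=\sum_{n=0}^N A_n^+(a)t^n$, regarded as a polynomial of degree $N$ in $a$, and for $\rho\in(0,1)$ let $\nu_N(\rho)$ be the number of its $a$-plane zeros (Yang-Lee zeros, with multiplicity) in the annulus $1-\rho\le|a|\le\frac1{1-\rho}$. If $\xi_t<\rho<1$, then \[ 0<1-\frac1\rho\xi_t\le\liminf_{N\to\infty}\frac1N\nu_N(\rho)\le\limsup_{N\to\infty}\frac1N\nu_N(\rho)\le1, \] and a positive fraction of Yang-Lee zeros of $G_N(a,t)$ are in the annulus $1-\rho<|a|<\frac1{1-\rho}$ in the complex $a$-plane.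
   Context: Let $\mathbb{L}^d_+$ be the half-lattice of the $d$-dimensional hypercubic lattice (vertices with last coordinate $\ge0$). A positive walk is a self-avoiding walk in $\mathbb{L}^d_+$ starting at the origin; its visits are its vertices other than the origin with last coordinate $0$. $c_n^+(v)$ is the number of positive walks of length $n$ with $v$ visits and $A_n^+(a)=\sum_{v=0}^n c_n^+(v)a^v$. $\mu_d$ and $\mu_{d-1}$ are the growth constants of self-avoiding walks in $d$ and $d-1$ dimensions, with the convention $\mu_1=1$. *)

(* Defs.v *)
From HB Require Import structures.
From mathcomp Require Import all_boot all_order all_algebra.
From mathcomp Require Import all_classical all_reals all_analysis.
From mathcomp Require Import complex.
Set Implicit Arguments. Unset Strict Implicit. Unset Printing Implicit Defensive.
Import Order.TTheory GRing.Theory Num.Theory.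
Local Open Scope ring_scope.

(* A walk of length n in the hypercubic lattice Z^d starting at the origin is
   encoded by its sequence of n unit steps: a step (i, b) moves by +1 (b = true)
   or -1 (b = false) along coordinate i.  Vertices are points of Z^d, encoded
   as finite functions 'I_d -> int. *)
Definition step (d : nat) (st : 'I_d * bool) : {ffun 'I_d -> int} :=
  [ffun i => if i == st.1 then (if st.2 then 1 else -1) else 0].

Definition vertices (d : nat) (s : seq ('I_d * bool)) : seq {ffun 'I_d -> int} :=
  0 :: scanl (fun p st => p + step st) 0 s.

Definition is_saw (d : nat) (s : seq ('I_d * bool)) : bool := uniq (vertices s).

Definition last_coord (d : nat) (p : {ffun 'I_d -> int}) : int :=
  odflt 0 (omap p (insub d.-1)).

Definition is_positive_walk (d : nat) (s : seq ('I_d * bool)) : bool :=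
  is_saw s && all (fun p => 0 <= last_coord p) (vertices s).

Definition visits (d : nat) (s : seq ('I_d * bool)) : nat :=
  count (fun p => last_coord p == 0) (behead (vertices s)).

Definition c_saw (d n : nat) : nat :=
  #|[set s : n.-tuple ('I_d * bool) | is_saw s]|.

Definition c_pos (d n v : nat) : nat :=
  #|[set s : n.-tuple ('I_d * bool) | is_positive_walk s && (visits s == v)]|.

Definition mu (R : realType) (d : nat) : R :=
  if d == 1%N then 1
  else limn (fun n : nat => (c_saw d n)%:R `^ (n%:R)^-1).

Definition Apos (R : realType) (d n : nat) : {poly R} :=
  \sum_(v < n.+1) (c_pos d n v)%:R *: 'X^v.

Definition G (R : realType) (d N : nat) (t : R) : {poly R} :=
  \sum_(n < N.+1) (t ^+ n) *: Apos R d n.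

Definition Gc (R : realType) (d N : nat) (t : R) : {poly R[i]} :=
  map_poly (fun x : R => (x%:C)%C) (G d N t).

(* the multiset of complex zeros (listed with multiplicity) of a polynomial *)
Definition zeros (R : realType) (p : {poly R[i]}) : seq R[i] :=
  sval (closed_field_poly_normal p).

Definition nu (R : realType) (d N : nat) (t rho : R) : nat :=
  count (fun z => (((1 - rho)%:C)%C <= `|z|) && (`|z| <= (((1 - rho)^-1)%:C)%C)) (zeros (Gc d N t)).

Definition nu_open (R : realType) (d N : nat) (t rho : R) : nat :=
  count (fun z => (((1 - rho)%:C)%C < `|z|) && (`|z| < (((1 - rho)^-1)%:C)%C)) (zeros (Gc d N t)).

(* Main.v *)
Require Import Defs.
From HB Require Import structures.
From mathcomp Require Import all_boot all_order all_algebra.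
From mathcomp Require Import all_classical all_reals all_analysis.
From mathcomp Require Import complex.
From mathcomp Require Import ring lra.
Import Order.TTheory GRing.Theory Num.Theory.
Import numFieldNormedType.Exports.
Local Open Scope ring_scope.

(* Let B bound the sums of c_n t^n, which are partial sums of a convergent series
   as t < 1 / mu_d.  The coefficients of G_N are nonnegative with sum at most B,
   the constant one is at least 1, and the top one is at least
   t^N c_N(d-1) >= (mu_{d-1} t)^N, since walks confined to the boundary
   hyperplane visit it at every step and c_n >= mu^n (Fekete).  Landau's
   inequality |lead p| prod max(1, |z|) <= |p|_2 <= |p|_1, applied to the zeros
   outside the unit disc and (through |p(0)|) to those inside it, gives
     (mu_{d-1} t)^N <= B^2 (1 - rho)^(N - nu_N(rho)),
   and the bound on nu_N / N follows by taking logarithms and using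
   ln (1 - rho) <= - rho. *)

(** * Landau's inequality and zeros outside an annulus *)

Section Landau.
Variable C : numClosedFieldType.
Implicit Types (p q : {poly C}) (s : seq C) (z : C).

(** This is the square of the usual l2 norm of the coefficients. *)
Definition l2norm p : C := \sum_(i < size p) `|p`_i| ^+ 2.

Lemma l2normE n p : (size p <= n)%N -> l2norm p = \sum_(i < n) `|p`_i| ^+ 2.
Proof.
move=> pn; rewrite /l2norm (big_ord_widen n (fun i => `|p`_i| ^+ 2)) // big_mkcond.
by apply: eq_bigr => i _; case: ltnP => // ip; rewrite nth_default // normr0 expr0n.
Qed.

(* Blaschke reflection: replacing the root z by 1 / z^* in this way multiplies
   the polynomial by a function of modulus 1 on the unit circle. *)
Lemma l2norm_reflect z q :
  l2norm ((z^* *: 'X - 1) * q) = l2norm (('X - z%:P) * q).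
Proof.
have sz (a b : C) : (size ((a *: 'X - b%:P) * q)%R <= (size q).+1)%N.
  apply: (leq_trans (size_polyMleq _ _)).
  have h : (size (a *: 'X - b%:P : {poly C})%R <= 2)%N.
    apply: (leq_trans (size_polyD _ _)); rewrite size_polyN geq_max.
    by rewrite (leq_trans (size_scale_leq _ _)) ?size_polyX // (leq_trans (size_polyC_leq1 _)).
  by case: (size _) h => [|[|[|]]] //= _; rewrite ?add1n ?add0n ?leq_pred // leqW ?leq_pred.
have coefE (a b : C) i : ((a *: 'X - b%:P) * q)`_i =
    a * (if i is j.+1 then q`_j else 0) - b * q`_i.
  by rewrite mulrBl coefB -scalerAl coefZ coefXM coefCM; case: i.
have szl := sz z^* 1; have szr := sz 1 z; have cl := coefE z^* 1; have cr := coefE 1 z.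
rewrite scale1r in szr cr; rewrite (l2normE _ _ szl) (l2normE _ _ szr).
(* Applied with a and b consecutive coefficients of [q], so that the corrections telescope. *)
have H (a b : C) : `|z^* * a - b| ^+ 2 =
    `|a - z * b| ^+ 2 + (`|z| ^+ 2 - 1) * (`|a| ^+ 2 - `|b| ^+ 2).
  by rewrite !normCK !rmorphB !rmorphM /= conjCK; ring.
under eq_bigr do rewrite cl mul1r H.
under [RHS]eq_bigr do rewrite cr mul1r.
rewrite big_split /= -mulr_sumr sumrB.
(* Both sums run over the squared moduli of the coefficients of [q], one of them shifted by an
   index, so they cancel. *)
rewrite [X in _ * (X - _)]big_ord_recl [X in _ * (_ - X)]big_ord_recr /=.
rewrite normr0 expr0n (nth_default _ (leqnn (size q))) normr0 expr0n.
by rewrite addr0 add0r subrr mulr0 addr0.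
Qed.

(** This is max(1, |z|); its product over the roots, times the modulus of the leading coefficient,
    is the Mahler measure. *)
Definition mahler_factor z : C := if 1 <= `|z| then `|z| else 1.

Lemma mahler_factor_ge1 z : 1 <= mahler_factor z.
Proof. by rewrite /mahler_factor; case: ifP. Qed.

(** The cofactor [q] is kept general for the induction: each linear factor is absorbed into it,
    after reflection when |z| >= 1. Reflection keeps the norm and multiplies the leading coefficient
    of [q] by a number of modulus |z|. *)
Lemma landau_inequality q s :
  `|lead_coef q| ^+ 2 * \prod_(z <- s) mahler_factor z ^+ 2
    <= l2norm (q * \prod_(z <- s) ('X - z%:P)).
Proof.
elim: s q => [|z s IH] q.
  rewrite !big_nil !mulr1.
  have [->|q0] := eqVneq q 0.
    by rewrite lead_coef0 normr0 expr0n sumr_ge0 // => i _; rewrite exprn_ge0.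
  rewrite /l2norm lead_coefE; move: q0; rewrite -size_poly_gt0; case: (size q) => // n _.
  by rewrite big_ord_recr /= lerDr sumr_ge0 // => i _; rewrite exprn_ge0.
have -> : `|lead_coef q| ^+ 2 * \prod_(x <- z :: s) mahler_factor x ^+ 2 =
    (`|lead_coef q| * mahler_factor z) ^+ 2 * \prod_(x <- s) mahler_factor x ^+ 2.
  by rewrite big_cons exprMn mulrA.
rewrite big_cons mulrCA; rewrite {1}/mahler_factor; case: ifP => z1.
  rewrite -l2norm_reflect mulrCA mulrA; apply: le_trans (IH _).
  rewrite lead_coefM normrM.
  (* Hence the reflected factor really has degree one and leading coefficient [z^*]. *)
  have z0 : z^* != 0.
    by rewrite conjC_eq0; apply: contraTneq z1 => ->; rewrite normr0 ler10.
  rewrite lead_coefDl; last by rewrite size_polyN size_polyC oner_eq0 size_scale // size_polyX.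
  by rewrite lead_coefZ lead_coefX mulr1 norm_conjC.
rewrite mulr1 mulrCA mulrA; apply: le_trans (IH _).
by rewrite lead_coefM lead_coefXsubC mulr1.
Qed.

Lemma l2norm_le p (B : C) : \sum_(i < size p) `|p`_i| <= B -> l2norm p <= B ^+ 2.
Proof.
have sn n : 0 <= \sum_(i < n) `|p`_i| by rewrite sumr_ge0.
move=> pB; apply: le_trans (_ : (\sum_(i < size p) `|p`_i|) ^+ 2 <= _); last first.
  by rewrite ler_sqr ?nnegrE // (le_trans _ pB).
rewrite /l2norm; elim: (size p) => [|n IH]; first by rewrite !big_ord0 expr0n.
rewrite !big_ord_recr /= sqrrD lerD2r (le_trans IH) // lerDl.
by apply/mulrn_wge0/mulr_ge0; [exact: sn | exact: normr_ge0].
Qed.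

(* Landau's inequality bounds the lead coefficient times the zeros outside the
   unit disc; dividing by the product of all zeros bounds those inside it. *)
Lemma annulus_zeros_bound p c s (r B : C) :
  p = c *: \prod_(z <- s) ('X - z%:P) -> 0 < r -> r <= 1 ->
  \sum_(i < size p) `|p`_i| <= B -> 1 <= `|p.[0]| ->
  `|c| <= B ^+ 2 * r ^+ count (fun z => ~~ ((r <= `|z|) && (`|z| <= r^-1))) s.
Proof.
move=> pE r0 r1 pB p0.
have B0 : 0 <= B by rewrite (le_trans _ pB) // sumr_ge0.
pose M := \prod_(z <- s) mahler_factor z.
have M0 : 0 <= M by rewrite prodr_ge0 // => z _; rewrite (le_trans ler01) ?mahler_factor_ge1.
have cM : `|c| * M <= B.
  rewrite -ler_sqr ?nnegrE ?mulr_ge0 // (le_trans _ (l2norm_le _ _ pB)) //.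
  have := landau_inequality c%:P s; rewrite lead_coefC mul_polyC -pE exprMn /M.
  by rewrite -prodrXl.
have p0E : `|p.[0]| = `|c| * \prod_(z <- s) `|z|.
  rewrite pE hornerZ normrM horner_prod normr_prod; congr (_ * _).
  by apply: eq_bigr => z _; rewrite !hornerE normrN.
pose no := count (fun z => ~~ (`|z| <= r^-1)) s.
pose ni := count (fun z => ~~ (r <= `|z|)) s.
(* A zero beyond 1/r has Mahler factor at least 1/r, which pays for one factor r. *)
have Mo : 1 <= M * r ^+ no.
  rewrite /M /no; elim: (s) => [|z s' IH]; first by rewrite big_nil mulr1.
  rewrite big_cons /= exprD mulrACA; apply: mulr_ege1 => //.
  case: (boolP (`|z| <= r^-1)) => /= [_|zr]; first by rewrite expr0 mulr1 mahler_factor_ge1.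
  have zr' : r^-1 < `|z| by rewrite real_ltNge // ?realV gtr0_real.
  have z1 : 1 <= `|z| by rewrite (le_trans _ (ltW zr')) // invf_ge1.
  by rewrite /mahler_factor z1 expr1 -ler_pdivrMr // div1r ltW.
(* A zero with |z| < r gains a factor r, since its Mahler factor is at least 1. *)
have Mi : \prod_(z <- s) `|z| <= M * r ^+ ni.
  rewrite /M /ni; elim: (s) => [|z s' IH]; first by rewrite !big_nil mulr1.
  rewrite !big_cons /= exprD mulrACA; apply: ler_pM => //; first exact: prodr_ge0.
  case: (boolP (r <= `|z|)) => /= [_|zr].
    rewrite expr0 mulr1 /mahler_factor; case: (boolP (1 <= `|z|)) => // h.
    by rewrite ltW // real_ltNge.
  have zr' : `|z| < r by rewrite real_ltNge // gtr0_real.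
  by rewrite expr1 (le_trans (ltW zr')) // ler_peMl ?mahler_factor_ge1 // ltW.
(* As r <= 1 <= 1/r, no zero violates both inequalities. *)
have -> : count (fun z => ~~ ((r <= `|z|) && (`|z| <= r^-1))) s = (no + ni)%N.
  rewrite /no /ni; elim: (s) => //= z s' ->.
  rewrite addnACA; congr (_ + _)%N.
  case: (boolP (r <= `|z|)) => zr /=; case: (boolP (`|z| <= r^-1)) => zr' //=.
  have h1 : r^-1 < `|z| by rewrite real_ltNge // ?realV gtr0_real.
  have h2 : `|z| < r by rewrite real_ltNge // gtr0_real.
  have := lt_trans h1 h2; rewrite real_ltNge ?realV ?gtr0_real //.
  by rewrite (le_trans r1) // invf_ge1.
have ro := exprn_ge0 no (ltW r0); have ri := exprn_ge0 ni (ltW r0).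
have cB : `|c| <= B * r ^+ no.
  by rewrite (le_trans (_ : _ <= `|c| * (M * r ^+ no))) ?ler_peMr // mulrA ler_wpM2r.
have Bi : 1 <= B * r ^+ ni.
  rewrite (le_trans p0) // p0E (le_trans (_ : _ <= `|c| * (M * r ^+ ni))) ?ler_wpM2l //.
  by rewrite mulrA ler_wpM2r.
rewrite exprD expr2 mulrACA (le_trans cB) // ler_peMr // mulr_ge0 //.
Qed.
End Landau.

(** * Fekete's lemma for nonnegative subadditive sequences *)

Section Fekete.
Local Open Scope classical_set_scope.
Variables (R : realType) (u : nat -> R).
Hypothesis u_ge0 : forall n, 0 <= u n.
Hypothesis u_sub : forall m n, u (m + n)%N <= u m + u n.

Definition fekete_inf : R := inf [set u n / n%:R | n in [set n : nat | (0 < n)%N]].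

Let has_inf_u : has_inf [set u n / n%:R | n in [set n : nat | (0 < n)%N]].
Proof.
split; first by exists (u 1 / 1%:R), 1%N.
by exists 0 => _ [n _ <-]; rewrite divr_ge0.
Qed.

Lemma fekete_inf_le n : (0 < n)%N -> fekete_inf <= u n / n%:R.
Proof. by move=> n0; apply: ge_inf; [exact: has_inf_u.2 | exists n]. Qed.

Lemma fekete_inf_ge0 : 0 <= fekete_inf.
Proof. by apply: lb_le_inf; [exact: has_inf_u.1 | move=> _ [n _ <-]; rewrite divr_ge0]. Qed.

(** Divide n by an m whose ratio u m / m is nearly the infimum. The affine bound, valid for every n,
    serves both the limit and the summability of the walk series. *)
Lemma fekete_upper (e : R) : 0 < e ->
  exists2 K, 0 <= K & forall n, u n <= n%:R * (fekete_inf + e) + K.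
Proof.
move=> e0; have [_ [m /= m0 <-] hm] := inf_adherent e0 has_inf_u.
(* Summing over all possible remainders bounds each of them. *)
exists (\sum_(i < m) u i); first by rewrite sumr_ge0.
have mul q r : u (q * m + r)%N <= q%:R * u m + u r.
  elim: q => [|q IH]; first by rewrite mul0n add0n mul0r add0r.
  rewrite mulSn -addnA (le_trans (u_sub _ _)) //.
  by rewrite -[q.+1%:R]nat1r mulrDl mul1r -addrA lerD2l.
move=> n; rewrite {1}(divn_eq n m); apply: (le_trans (mul _ _)).
have rm := ltn_pmod n m0.
apply: lerD; last first.
  rewrite (bigD1 (Ordinal rm)) //= lerDl sumr_ge0 //.
rewrite -/fekete_inf in hm.
have m0' : 0 < m%:R :> R by rewrite ltr0n.
have -> : (n %/ m)%:R * u m = ((n %/ m) * m)%:R * (u m / m%:R).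
  by rewrite natrM; field; rewrite gt_eqF.
apply: ler_pM => //; [by rewrite divr_ge0| |exact: ltW].
by rewrite ler_nat leq_divM.
Qed.

Lemma fekete : u n / n%:R @[n --> \oo] --> fekete_inf.
Proof.
apply/cvgrPdist_le => e e0.
have e2 : 0 < e / 2 by rewrite divr_gt0.
have [K K0 hK] := fekete_upper _ e2.
near=> n.
have n0 : (0 < n)%N by near: n; exists 1%N.
have n0' : 0 < n%:R :> R by rewrite ltr0n.
rewrite distrC ger0_norm ?subr_ge0 ?fekete_inf_le //.
rewrite lerBlDl ler_pdivrMr //; apply: (le_trans (hK n)).
suff : K <= n%:R * (e / 2) by lra.
rewrite -ler_pdivrMr //; near: n; exact: nbhs_infty_ger.
Unshelve. all: by end_near. Qed.

End Fekete.

(** * Growth constants of submultiplicative sequences *)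

Lemma geometric_sum_le (R : realFieldType) (q : R) N : 0 <= q -> q < 1 ->
  \sum_(n < N) q ^+ n <= (1 - q)^-1.
Proof.
move=> q0 q1; have q1' : 0 < 1 - q by rewrite subr_gt0.
rewrite -[leRHS]mul1r ler_pdivlMr // mulrC.
have -> : (1 - q) * \sum_(n < N) q ^+ n = 1 - q ^+ N by rewrite -opprB mulNr -subrX1 opprB.
by rewrite gerBl exprn_ge0.
Qed.

Section Growth.
Variables (R : realType) (c : nat -> nat).
Hypothesis c_gt0 : forall n, (0 < c n)%N.
Hypothesis c_submul : forall m n, (c (m + n) <= c m * c n)%N.

Local Notation u := (fun n => ln (c n)%:R : R).
Let u_ge0 n : 0 <= u n.
Proof. by rewrite ln_ge0 // ler1n. Qed.
Let u_sub m n : u (m + n)%N <= u m + u n.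
Proof.
by rewrite -lnM ?posrE ?ltr0n // ler_ln ?posrE ?mulr_gt0 ?ltr0n // -natrM ler_nat.
Qed.

Definition growth : R := limn (fun n : nat => (c n)%:R `^ (n%:R)^-1).

Lemma growthE : growth = expR (fekete_inf R u).
Proof.
apply: cvg_lim => //.
(* This holds at n = 0 too: the inverse of 0 is 0, so both sides are 1. *)
have -> : (fun n => (c n)%:R `^ (n%:R)^-1) = expR \o (fun n => u n / n%:R).
  apply/funext => n /=; rewrite /powR pnatr_eq0 -leqn0 leqNgt c_gt0 /=.
  by rewrite mulrC.
apply: continuous_cvg; [exact: continuous_expR | exact: fekete].
Qed.

Lemma growth_ge1 : 1 <= growth.
Proof. by rewrite growthE -[leLHS]expR0 ler_expR; exact: (fekete_inf_ge0 R u u_ge0). Qed.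

Lemma growth_exp_le n : growth ^+ n <= (c n)%:R.
Proof.
have [->|n0] := posnP n; first by rewrite expr0 ler1n.
rewrite growthE -expRM_natl -[leRHS]lnK ?posrE ?ltr0n // ler_expR.
by rewrite mulrC -ler_pdivlMr ?ltr0n //; exact: (fekete_inf_le R u u_ge0).
Qed.

Lemma growth_series_bounded (t : R) : 0 < t -> t < growth^-1 ->
  exists B, forall N, \sum_(n < N) (c n)%:R * t ^+ n <= B.
Proof.
move=> t0; rewrite growthE -expRN => tg.
have lt : ln t < - fekete_inf R u by rewrite -ltr_expR lnK.
set L := fekete_inf R u in lt.
(* Half the gap between ln t and -L: the terms are then at most exp(K - n e). *)
pose e := - (L + ln t) / 2.
have e0 : 0 < e by rewrite /e; lra.
have [K _ hK] := fekete_upper R u u_ge0 u_sub _ e0.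
exists (expR K * (1 - expR (- e))^-1) => N.
apply: (@le_trans _ _ (\sum_(n < N) expR K * expR (- e) ^+ n)).
  apply: ler_sum => n _.
  rewrite -[(c n)%:R]lnK ?posrE ?ltr0n // -[t]lnK // -!expRM_natl -!expRD ler_expR.
  by have := hK n; rewrite /= -/L /e; lra.
rewrite -mulr_sumr ler_pM2l ?expR_gt0 // geometric_sum_le ?expR_ge0 //.
by rewrite expR_lt1; lra.
Qed.
End Growth.

(** * Counting self-avoiding and positive walks *)

Section Walks.
Variable d : nat.
Implicit Types s : seq ('I_d * bool).

Lemma scanl_step_shift (p : {ffun 'I_d -> int}) s :
  scanl (fun p st => p + step st) p s =
  [seq p + x | x <- scanl (fun p st => p + step st) 0 s].
Proof.
elim: s p => //= st s IH p.
rewrite IH [X in _ = _ :: map _ X]IH -map_comp add0r; congr cons.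
by apply: eq_map => x /=; rewrite addrA.
Qed.

Lemma is_saw_cat s1 s2 : is_saw (s1 ++ s2) -> is_saw s1 && is_saw s2.
Proof.
rewrite /is_saw /vertices scanl_cat -cat_cons cat_uniq => /and3P[-> /hasPn h u2] /=.
(* The junction [e] is the last vertex of [s1] and the starting point of the translated [s2]; a
   return of [s2] to its origin would be a second passage through [e]. *)
set e := foldl _ _ _ in h u2.
have e1 : e \in vertices s1.
  rewrite /e /vertices; elim: s1 (0 : {ffun 'I_d -> int}) {h u2 e} => [|st s IH] x //=.
    by rewrite inE.
  by rewrite inE IH orbT.
rewrite scanl_step_shift map_inj_uniq in u2; last exact: addrI.
rewrite u2 andbT; apply/negP => h0.
have := h e; rewrite scanl_step_shift => /(_ _)/negP; apply => //.
by apply/mapP; exists 0; rewrite ?addr0.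
Qed.

Lemma c_saw_submul m n : (c_saw d (m + n) <= c_saw d m * c_saw d n)%N.
Proof.
rewrite /c_saw -cardsX.
pose f (p : m.-tuple ('I_d * bool) * n.-tuple ('I_d * bool)) := cat_tuple p.1 p.2.
apply: leq_trans (leq_imset_card f _); apply: subset_leq_card.
apply/fintype.subsetP => s; rewrite !inE => saws.
have s1 : size (take m s) == m by rewrite size_takel // size_tuple leq_addr.
have s2 : size (drop m s) == n by rewrite size_drop size_tuple addKn.
have sE : s = f (Tuple s1, Tuple s2) by apply: val_inj; rewrite /= cat_take_drop.
apply/imsetP; exists (Tuple s1, Tuple s2) => //.
by move: saws; rewrite !inE /= -{1}(cat_take_drop m s); exact: is_saw_cat.
Qed.

End Walks.

(** The straight walk along the first axis is self-avoiding: its first coordinates are 0, 1, ...,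
    n. *)
Lemma c_saw_gt0 d n : (0 < d)%N -> (0 < c_saw d n)%N.
Proof.
case: d => // d _; rewrite /c_saw card_gt0; apply/set0Pn.
exists [tuple of nseq n (ord0 : 'I_d.+1, true)]; rewrite inE /is_saw.
apply: (@map_uniq _ _ (fun p : {ffun 'I_d.+1 -> int} => p ord0)).
suff h : forall k (p : {ffun 'I_d.+1 -> int}), p ord0 = k%:Z ->
    [seq p0 ord0 | p0 : {ffun 'I_d.+1 -> int} <-
      p :: scanl (fun p st => p + step st) p (nseq n (ord0, true))] =
    map Posz (iota k n.+1).
  by rewrite (h 0%N) ?ffunE // map_inj_uniq ?iota_uniq // => i j [].
elim: n => [|n IH] k p pk; first by rewrite /= pk.
have h : (p + step (ord0, true)) ord0 = k.+1%:Z.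
  by rewrite !ffunE eqxx /= pk -PoszD addn1.
by have /= := IH k.+1 _ h; rewrite /= pk => ->.
Qed.

(** A walk in dimension d is placed in the boundary hyperplane by appending a zero coordinate ([ext]
    on points, [up] on steps); all its n later vertices are then visits. *)
Lemma c_pos_visits_all d n : (c_saw d n <= c_pos d.+1 n n)%N.
Proof.
pose up (st : 'I_d * bool) : 'I_d.+1 * bool := (widen_ord (leqnSn d) st.1, st.2).
have up_inj : injective up.
  by move=> [i b] [j b'] [] /= ij ->; congr pair; apply: val_inj.
pose ext (p : {ffun 'I_d -> int}) : {ffun 'I_d.+1 -> int} :=
  [ffun i : 'I_d.+1 => odflt 0 (omap p (insub (val i)))].
have extD p q : ext (p + q) = ext p + ext q.
  by apply/ffunP => i; rewrite !ffunE; case: insub => [j|] //=; rewrite ?ffunE ?addr0.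
have ext0 : ext 0 = 0.
  by apply/ffunP => i; rewrite !ffunE; case: insub => [j|] //=; rewrite ?ffunE.
have ext_inj : injective ext.
  move=> p q /ffunP pq; apply/ffunP => i.
  by have := pq (widen_ord (leqnSn d) i); rewrite !ffunE /= valK.
have ext_step st : ext (step st) = step (up st).
  apply/ffunP => i; rewrite !ffunE /=; case: insubP => [j _ ji|] /=.
    by rewrite ffunE -!val_eqE /= ji.
  rewrite -leqNgt => di; case: eqP => // ie; move: di.
  by rewrite ie /= leqNgt ltn_ord.
have ext_last p : last_coord (ext p) = 0.
  rewrite /last_coord /=; case: insubP => [j _ jd|] //=.
  by rewrite ffunE jd insubF // ltnn.
have vE s : vertices (map up s) = map ext (vertices s).
  rewrite /vertices /= ext0; congr cons.
  rewrite -{1}ext0; elim: s (0 : {ffun 'I_d -> int}) => //= st s IH p.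
  by rewrite -ext_step -extD IH.
rewrite /c_saw /c_pos.
pose f (s : n.-tuple ('I_d * bool)) := map_tuple up s.
rewrite -(card_in_imset (f := f)); last first.
  by move=> x y _ _ [] /(inj_map up_inj) xy; apply: val_inj.
apply: subset_leq_card; apply/fintype.subsetP => _ /imsetP[s + ->].
rewrite !inE /is_positive_walk /is_saw /visits vE map_inj_uniq // => -> /=.
rewrite -/(map ext _) !all_map ext_last /=; apply/andP; split.
  by apply/allP => p _ /=; rewrite ext_last.
rewrite count_map (eq_count (a2 := predT)) ?count_predT ?size_scanl ?size_tuple //.
by move=> p /=; rewrite ext_last.
Qed.

(** Exchanging the sums, each walk is counted for at most one value of v. *)
Lemma sum_c_pos_le d n : (\sum_(v < n.+1) c_pos d n v <= c_saw d n)%N.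
Proof.
rewrite /c_pos /c_saw.
under eq_bigr do rewrite -sum1_card big_mkcond.
rewrite exchange_big -sum1_card [leqRHS]big_mkcond /=; apply: leq_sum => s _.
under eq_bigr do rewrite inE.
rewrite inE; case: (boolP (is_positive_walk s)) => [/andP[-> _]|_] /=; last by rewrite big1.
rewrite -big_mkcond /= sum1_card.
(* A number of visits above n would match no summand, so the bound holds in either case. *)
have [vn|vn] := ltnP (visits s) n.+1.
  by rewrite (eq_card (B := pred1 (Ordinal vn))) ?card1 // => v; rewrite inE /= eq_sym.
rewrite eq_card0 // => v; rewrite inE; apply/negbTE; apply: contraTneq vn => ->.
by rewrite -ltnNge.
Qed.

Lemma c_pos00 d : (0 < c_pos d 0 0)%N.
Proof.
rewrite card_gt0; apply/set0Pn; exists [tuple]; rewrite inE /is_positive_walk /=.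
by rewrite /last_coord; case: insub => [i|] //=; rewrite ffunE.
Qed.

(** * Coefficients and zeros of the partition function *)

Section PartitionFunction.
Variables (R : realType) (m : nat) (t : R).
Hypotheses (m_gt0 : (0 < m)%N) (t_gt0 : 0 < t).

Lemma coef_Apos d n v :
  (Apos R d n)`_v = if (v < n.+1)%N then (c_pos d n v)%:R else 0.
Proof.
by have -> : Apos R d n = \poly_(i < n.+1) (c_pos d n i)%:R; rewrite (poly_def, coef_poly).
Qed.

Lemma coef_G_ge0 d N v : 0 <= (G d N t)`_v.
Proof.
rewrite /G coef_sum sumr_ge0 // => n _; rewrite coefZ coef_Apos.
by apply: mulr_ge0; [rewrite exprn_ge0 // ltW | case: ifP].
Qed.

Lemma size_G_le d N : (size (G d N t) <= N.+1)%N.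
Proof.
apply/leq_sizeP => v Nv; rewrite /G coef_sum big1 // => n _.
by rewrite coefZ coef_Apos ltnNge (leq_trans (ltn_ord n) Nv) mulr0.
Qed.

(** Only walks of length N reach degree N in a, and those with N visits include all walks of the
    hyperplane. *)
Lemma coef_G_top N : t ^+ N * (c_saw m N)%:R <= (G m.+1 N t)`_N.
Proof.
rewrite /G coef_sum big_ord_recr /= coefZ coef_Apos ltnSn big1 ?add0r; last first.
  by move=> n _; rewrite coefZ coef_Apos ltnNge ltn_ord mulr0.
by rewrite ler_wpM2l ?exprn_ge0 ?ler_nat ?c_pos_visits_all // ltW.
Qed.

Lemma coef_G_top_gt0 N : 0 < (G m.+1 N t)`_N.
Proof.
apply: lt_le_trans (coef_G_top N).
by rewrite mulr_gt0 ?exprn_gt0 // ltr0n c_saw_gt0.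
Qed.

Lemma size_G N : size (G m.+1 N t) = N.+1.
Proof.
apply/eqP; rewrite eqn_leq size_G_le /= ltnNge; apply/negP => sN.
by have := coef_G_top_gt0 N; rewrite nth_default // ltxx.
Qed.

(** The empty walk contributes 1 to the constant coefficient. *)
Lemma coef_G0_ge1 d N : 1 <= (G d N t)`_0.
Proof.
rewrite /G coef_sum big_ord_recl /= coefZ coef_Apos expr0 mul1r.
apply: (@le_trans _ _ (c_pos d 0 0)%:R); first by rewrite ler1n c_pos00.
rewrite lerDl sumr_ge0 // => n _; rewrite coefZ coef_Apos.
by rewrite mulr_ge0 // exprn_ge0 // ltW.
Qed.

Lemma sum_coef_G_le d N :
  \sum_(i < size (G d N t)) (G d N t)`_i <= \sum_(n < N.+1) (c_saw d n)%:R * t ^+ n.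
Proof.
(* At a = 1 the walks are no longer distinguished by their visits. *)
have -> : \sum_(i < size (G d N t)) (G d N t)`_i = (G d N t).[1].
  by rewrite horner_coef; apply: eq_bigr => i _; rewrite expr1n mulr1.
rewrite /G horner_sum; apply: ler_sum => n _.
rewrite hornerZ mulrC ler_wpM2r ?exprn_ge0 ?(ltW t_gt0) //.
apply: le_trans (_ : (\sum_(v < n.+1) c_pos d n v)%:R <= _); last by rewrite ler_nat sum_c_pos_le.
rewrite /Apos horner_sum natr_sum; apply: ler_sum => v _.
by rewrite hornerZ hornerXn expr1n mulr1.
Qed.

Lemma size_zeros_Gc N : size (zeros (Gc m.+1 N t)) = N.
Proof.
have G0 : lead_coef (Gc m.+1 N t) != 0.
  rewrite lead_coef_eq0 map_poly_eq0 -size_poly_gt0 size_G //.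
rewrite /zeros; case: closed_field_poly_normal => s /= /(congr1 (fun p : {poly R[i]} => size p)).
by rewrite size_scale // size_prod_XsubC size_map_poly size_G => -[].
Qed.

Lemma nu_le N rho : (nu m.+1 N t rho <= N)%N.
Proof. by rewrite -[leqRHS]size_zeros_Gc count_size. Qed.

Lemma lead_coef_le_annulus N rho B : 0 < rho -> rho < 1 ->
  \sum_(n < N.+1) (c_saw m.+1 n)%:R * t ^+ n <= B ->
  t ^+ N * (c_saw m N)%:R <= B ^+ 2 * (1 - rho) ^+ (N - nu m.+1 N t rho).
Proof.
move=> rho0 rho1 hB.
have coefC i : (Gc m.+1 N t)`_i = ((G m.+1 N t)`_i)%:C%C by rewrite coef_map.
have szC : size (Gc m.+1 N t) = N.+1 by rewrite size_map_poly size_G.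
have zE : Gc m.+1 N t = lead_coef (Gc m.+1 N t) *: \prod_(z <- zeros (Gc m.+1 N t)) ('X - z%:P).
  by rewrite /zeros; case: closed_field_poly_normal.
have normC (x : R) : 0 <= x -> `|x%:C%C| = x%:C%C by move=> x0; rewrite ger0_norm ?ler0c.
have C1 : (1 : R[i]) = 1%:C%C by [].
have r0 : 0 < (1 - rho)%:C%C by rewrite ltcR subr_gt0.
have r1 : (1 - rho)%:C%C <= 1 by rewrite C1 lecR; lra.
have sB : \sum_(i < size (Gc m.+1 N t)) `|(Gc m.+1 N t)`_i| <= B%:C%C.
  apply: le_trans (_ : (\sum_(i < size (G m.+1 N t)) (G m.+1 N t)`_i)%:C%C <= _); last first.
    by rewrite lecR (le_trans (sum_coef_G_le _ _)).
  rewrite szC size_G rmorph_sum; apply: ler_sum => i _.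
  by rewrite coefC normC ?coef_G_ge0.
have p0 : 1 <= `|(Gc m.+1 N t).[0]|.
  rewrite horner_coef0 coefC normC ?coef_G_ge0 // C1 lecR; exact: coef_G0_ge1.
have := annulus_zeros_bound _ _ _ _ _ _ zE r0 r1 sB p0.
rewrite lead_coefE szC coefC normC ?coef_G_ge0 //=.
set k := count _ _.
(* There are exactly N zeros, so those outside the annulus are the complement of those counted by
   [nu]. *)
have -> : k = (N - nu m.+1 N t rho)%N.
  rewrite -[X in (X - _)%N]size_zeros_Gc /nu.
  rewrite -(count_predC (fun z => (((1 - rho)%:C)%C <= `|z|) && (`|z| <= (((1 - rho)^-1)%:C)%C))).
  by rewrite addKn; apply: eq_count => z /=; rewrite fmorphV.
rewrite -!rmorphXn -rmorphM lecR; apply: le_trans; exact: coef_G_top.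
Qed.
End PartitionFunction.

(** * Asymptotic density of zeros in the annulus *)

Lemma limn_einf_ge (R : realType) (u : nat -> \bar R) (a : \bar R) N :
  (forall n, (N <= n)%N -> (a <= u n)%E) -> (a <= limn_einf u)%E.
Proof.
move=> h; rewrite limn_einf_lim; apply: lime_ge; first exact: is_cvg_einfs.
near=> n; apply: le_ereal_inf_tmp => _ [k /= nk <-]; apply: h; apply: leq_trans nk.
by near: n; exact: nbhs_infty_ge.
Unshelve. all: by end_near. Qed.

Lemma limn_esup_le (R : realType) (u : nat -> \bar R) (a : \bar R) :
  (forall n, (u n <= a)%E) -> (limn_esup u <= a)%E.
Proof.
move=> h; rewrite limn_esup_lim; apply: lime_le; first exact: is_cvg_esups.
by near=> n; apply: ge_ereal_sup => _ [k /= nk <-].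
Unshelve. all: by end_near. Qed.

Lemma mu_ge1 (R : realType) d : (0 < d)%N -> 1 <= mu R d.
Proof.
move=> d0; rewrite /mu; case: ifP => // _.
by apply: growth_ge1 => [n|i j]; [exact: c_saw_gt0 | exact: c_saw_submul].
Qed.

Lemma mu_exp_le (R : realType) d n : (0 < d)%N -> mu R d ^+ n <= (c_saw d n)%:R.
Proof.
move=> d0; rewrite /mu; case: ifP => _; first by rewrite expr1n ler1n c_saw_gt0.
by apply: growth_exp_le => [k|i j]; [exact: c_saw_gt0 | exact: c_saw_submul].
Qed.

Lemma saw_series_bounded (R : realType) d (t : R) : (1 < d)%N ->
  0 < t -> t < (mu R d)^-1 ->
  exists B, forall N, \sum_(n < N) (c_saw d n)%:R * t ^+ n <= B.
Proof.
move=> d1 t0; rewrite /mu gtn_eqF //; apply: growth_series_bounded => //.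
  by move=> n; apply: c_saw_gt0; apply: ltnW.
exact: c_saw_submul.
Qed.

(** The slack e absorbs the error 2 ln B / (rho N) coming from the factor B^2. *)
Lemma nu_density_ge (R : realType) m (t rho e : R) : (0 < m)%N ->
  0 < t -> t < (mu R m.+1)^-1 -> 0 < rho -> rho < 1 -> 0 < e ->
  exists N0, forall N, (N0 <= N)%N ->
    1 - `|ln (mu R m * t)| / rho - e <= (nu m.+1 N t rho)%:R / N%:R.
Proof.
move=> m0 t0 tmu rho0 rho1 e0; set xi := `|_|.
have [B hB] := @saw_series_bounded R m.+1 t m0 t0 tmu.
have B1 : 1 <= B.
  apply: le_trans (hB 1%N); rewrite big_ord1 expr0 mulr1 ler1n.
  exact: c_saw_gt0.
have B0 : 0 < B by exact: lt_le_trans B1.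
have mu0 : 0 < mu R m * t by rewrite mulr_gt0 // (lt_le_trans ltr01) // mu_ge1.
have key N : (N%:R - (nu m.+1 N t rho)%:R) * rho <= 2 * ln B + N%:R * xi.
  have := lead_coef_le_annulus R m t m0 t0 N rho B rho0 rho1 (hB N.+1).
  rewrite -natrB ?nu_le //; set k := (N - _)%N => h.
  have {}h : (mu R m * t) ^+ N <= B ^+ 2 * (1 - rho) ^+ k.
    apply: le_trans h; rewrite exprMn mulrC ler_wpM2l ?exprn_ge0 ?(ltW t0) //.
    exact: mu_exp_le.
  have r0 : 0 < 1 - rho by rewrite subr_gt0.
  have lr : ln (1 - rho) <= - rho by apply: le_ln1Dx; rewrite ltrN2.
  move: h; rewrite -ler_ln ?posrE ?mulr_gt0 ?exprn_gt0 //.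
  rewrite lnM ?posrE ?exprn_gt0 // !lnXn // -![ln _ *+ _]mulr_natl.
  have hx : - xi <= ln (mu R m * t) by rewrite lerNl /xi -normrN ler_norm.
  have h1 : k%:R * ln (1 - rho) <= k%:R * - rho by rewrite ler_wpM2l.
  have h2 : N%:R * - xi <= N%:R * ln (mu R m * t) by rewrite ler_wpM2l.
  by lra.
(* From this rank on 2 ln B <= N rho e; the successor also ensures N > 0. *)
exists (Num.truncn (2 * ln B / (rho * e))).+1 => N N0N.
have N0' : 0 < N%:R :> R by rewrite ltr0n (leq_trans _ N0N).
have hN : 2 * ln B <= N%:R * (rho * e).
  rewrite -ler_pdivrMr ?mulr_gt0 //; apply: ltW; apply: lt_le_trans (truncnS_gt _) _.
  by rewrite ler_nat.
rewrite ler_pdivlMr // -(ler_pM2l rho0).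
have -> : rho * ((1 - xi / rho - e) * N%:R) = N%:R * rho - N%:R * xi - N%:R * (rho * e).
  by field; rewrite gt_eqF.
by have := key N; lra.
Qed.

Theorem theorem2p11 (R : realType) (d : nat) (t rho : R) :
  (2 <= d)%N ->
  (expR 1 * mu R d.-1)^-1 < t -> t < (mu R d)^-1 ->
  let xi : R := `|ln (mu R d.-1 * t)| in
  xi < rho -> rho < 1 ->
  let u := fun N : nat => ((nu d N t rho)%:R / N%:R : R)%:E in
  let u_open := fun N : nat => ((nu_open d N t rho)%:R / N%:R : R)%:E in
  0 < 1 - xi / rho /\
  ((1 - xi / rho)%:E <= limn_einf u)%E /\
  (limn_einf u <= limn_esup u)%E /\
  (limn_esup u <= (1 : R)%:E)%E /\
  (0 < limn_einf u_open)%E.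
Proof.
case: d => [//|m] m0 /= tl tu xirho rho1.
set xi := `|_| in xirho *.
have {tl} t0 : 0 < t.
  apply: lt_trans tl; rewrite invr_gt0 mulr_gt0 ?expR_gt0 //.
  by rewrite (lt_le_trans ltr01) // mu_ge1.
have xi0 : 0 <= xi by exact: normr_ge0.
have rho0 : 0 < rho by exact: le_lt_trans xirho.
split; first by rewrite subr_gt0 ltr_pdivrMr // mul1r.
split.
  apply/lee_subgt0Pr => e e0.
  have [N0 hN0] := nu_density_ge R m t rho e m0 t0 tu rho0 rho1 e0.
  by apply: (limn_einf_ge _ _ _ N0) => N /hN0; rewrite -EFinB lee_fin.
split; first exact: limn_einf_sup.
split.
  apply: limn_esup_le => N; rewrite lee_fin.
  (* At N = 0 the quotient is 0 by the convention on inverses. *)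
  have [->|N0] := posnP N; first by rewrite invr0 mulr0.
  by rewrite ler_pdivrMr ?ltr0n // mul1r ler_nat nu_le.
(* the closed annulus of any intermediate width lies in the open one *)
pose rho' := (xi + rho) / 2.
have rho'0 : 0 < rho' by rewrite /rho'; lra.
have rho'1 : rho' < 1 by rewrite /rho'; lra.
have pos : 0 < 1 - xi / rho' by rewrite subr_gt0 ltr_pdivrMr // mul1r /rho'; lra.
(* Half of the bound is given up as slack, and the other half is a positive lower bound for the
   density. *)
pose e := (1 - xi / rho') / 2.
have e0 : 0 < e by rewrite /e; lra.
have [N0 hN0] := nu_density_ge R m t rho' e m0 t0 tu rho'0 rho'1 e0.
apply: (@lt_le_trans _ _ e%:E); first by rewrite lte_fin.
apply: (limn_einf_ge _ _ _ N0) => N /hN0; rewrite lee_fin -/xi => h.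
apply: le_trans (_ : (nu m.+1 N t rho')%:R / N%:R <= _).
  by apply: le_trans h; rewrite /e; lra.
rewrite ler_wpM2r ?invr_ge0 // ler_nat; apply: sub_count => z /andP[z1 z2].
have r'r : 1 - rho < 1 - rho' by rewrite /rho'; lra.
have r0 : 0 < 1 - rho by rewrite subr_gt0.
apply/andP; split; first by apply: lt_le_trans z1; rewrite ltcR.
apply: le_lt_trans z2 _; rewrite ltcR ltf_pV2 // posrE //.
exact: lt_trans r'r.
Qed.
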